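(* Let $f$ be a transcendental entire function with $f(0)=0$, and let $$R_f=\max\{r\ge 0: M^n(r)\nrightarrow\infty\text{ as }n\to\infty\}.$$ Then $$A(f)=\bigcup_{R>R_f}A_R(f).$$
   Context: $M(r)=M(r,f)=\max_{|z|=r}|f(z)|$ for $r\ge 0$, and $M^n(r)$ denotes the $n$-th iterate of $r\mapsto M(r)$; $\mathbb N=\{1,2,\dots\}$. For $R>0$ such that $M^n(R)\to\infty$ as $n\to\infty$, $A_R(f)=\{z\in\mathbb C:|f^n(z)|\ge M^n(R),\ n\in\mathbb N\}$. The fast escaping set is $$A(f)=\{z: \text{there exists }\ell\in\mathbb N\text{ such that }|f^{n+\ell}(z)|\ge M^n(R),\ \text{for } n\in\mathbb N\},$$ where $R>0$ is any number such that $M^n(R)\to\infty$ as $n\to\infty$ (the set $A(f)$ is known not to depend on the choice of such $R$). *)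

(* Defs.v *)
(* Built on Stdlib's reals with Coquelicot. *)
From Stdlib Require Import Reals ClassicalEpsilon.
From Coquelicot Require Import Coquelicot.

Open Scope R_scope.

Definition entire (f : C -> C) : Prop :=
  forall z : C, ex_derive (K := C_AbsRing) (V := C_NormedModule) f z.

Definition polynomial_function (f : C -> C) : Prop :=
  exists (d : nat) (a : nat -> C),
    forall z : C, f z = sum_n (fun k => Cmult (a k) (Cpow z k)) d.

Definition transcendental_entire (f : C -> C) : Prop :=
  entire f /\ ~ polynomial_function f.

Definition is_max (E : R -> Prop) (m : R) : Prop :=
  E m /\ is_upper_bound E m.

(* An unspecified real when [E] has no maximum. *)
Definition max_of (E : R -> Prop) : R := epsilon (inhabits 0) (is_max E).

(* Only meaningful for [0 <= r]: the circle is empty when [r < 0]. *)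
Definition max_modulus (f : C -> C) (r : R) : R :=
  max_of (fun x => exists z : C, Cmod z = r /\ x = Cmod (f z)).

Definition max_modulus_iter (f : C -> C) (n : nat) (r : R) : R :=
  Nat.iter n (max_modulus f) r.

Definition radius_escapes (f : C -> C) (r : R) : Prop :=
  is_lim_seq (fun n => max_modulus_iter f n r) p_infty.

Definition nonescaping_radius (f : C -> C) (r : R) : Prop :=
  0 <= r /\ ~ radius_escapes f r.

Definition R_of (f : C -> C) : R := max_of (nonescaping_radius f).

(* [A_R(f)] for [R = rho], where [rho > 0] and [radius_escapes f rho]; these
   two conditions are left to the user of the definition.  They hold for every
   [rho > R_of f] as soon as [R_of f] is a genuine maximum.  The natural
   numbers start at 1 here and below. *)
Definition A_level (f : C -> C) (rho : R) (z : C) : Prop :=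
  forall n : nat, (1 <= n)%nat ->
    max_modulus_iter f n rho <= Cmod (Nat.iter n f z).

(* [A(f)] computed from the admissible radius [rho]. *)
Definition fast_escaping (f : C -> C) (rho : R) (z : C) : Prop :=
  exists l : nat, (1 <= l)%nat /\
    forall n : nat, (1 <= n)%nat ->
      max_modulus_iter f n rho <= Cmod (Nat.iter (n + l) f z).

(* Main.v *)
(* Three facts about [M = max_modulus f] suffice: it is nondecreasing, it is
   continuous, and [M r > r] for all large [r].  Put [m = R_of f].  Since [M^n m <= m]
   for all [n], an orbit that ever meets the disc [|z| <= m] stays in it, so a fast
   escaping orbit keeps [|f^n z| > m]; by continuity of the finitely many iterates
   [M^n], [n <= l], at [m], some [R' > m] satisfies [M^n R' <= |f^n z|] for [n <= l] and
   [M^l R' <= rho], and the remaining [n] follow by monotonicity.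

   No integral formula is needed for the facts on [M].  Goursat's lemma on rectangles
   gives a real primitive of [Re f]; its difference quotients are twice differentiable
   and harmonic, so the elementary second-derivative maximum principle applies to them
   and passes to [f].  If [M r <= r] for arbitrarily large [r], the maximum principle
   applied to a suitable entire function forces [f z = z f(1)]. *)
Require Import Defs.
From Stdlib Require Import Reals ClassicalEpsilon Lra Lia.
From Coquelicot Require Import Coquelicot.

Open Scope R_scope.

(** * Continuity of functions of two real variables *)

Lemma continuity_2d_pt_comp (f g h : R -> R -> R) (x y : R) :
  continuity_2d_pt f (g x y) (h x y) ->
  continuity_2d_pt g x y -> continuity_2d_pt h x y ->
  continuity_2d_pt (fun u v => f (g u v) (h u v)) x y.
Proof.
intros Hf Hg Hh eps.
destruct (Hf eps) as [d Hd].
destruct (Hg d) as [d1 H1]; destruct (Hh d) as [d2 H2].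
exists (mkposreal _ (Rmin_stable_in_posreal d1 d2)); simpl; intros u v Hu Hv.
apply Hd; [apply H1 | apply H2];
  (eapply Rlt_le_trans; [eassumption | apply Rmin_l || apply Rmin_r]).
Qed.

Lemma continuity_2d_pt_section1 (f : R -> R -> R) (x y : R) :
  continuity_2d_pt f x y -> continuous (fun t => f t y) x.
Proof.
intros Hf; apply continuity_pt_filterlim.
intros eps Heps; destruct (Hf (mkposreal eps Heps)) as [d Hd].
exists d; split; [apply cond_pos|].
intros t [_ Ht]; apply Hd; [exact Ht|].
rewrite Rminus_eq_0, Rabs_R0; apply cond_pos.
Qed.

Lemma continuity_2d_pt_swap (f : R -> R -> R) (x y : R) :
  continuity_2d_pt f x y -> continuity_2d_pt (fun u v => f v u) y x.
Proof.
intros Hf eps; destruct (Hf eps) as [d Hd]; exists d; intros u v Hu Hv; now apply Hd.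
Qed.

Lemma continuity_2d_pt_section2 (f : R -> R -> R) (x y : R) :
  continuity_2d_pt f x y -> continuous (fun t => f x t) y.
Proof.
intros Hf; exact (continuity_2d_pt_section1 _ _ _ (continuity_2d_pt_swap _ _ _ Hf)).
Qed.

Lemma differentiable_pt_lim_continuity (f : R -> R -> R) (x y lx ly : R) :
  differentiable_pt_lim f x y lx ly -> continuity_2d_pt f x y.
Proof.
intros H; apply differentiable_continuity_pt; now exists lx, ly.
Qed.

(** The maximizers may jump with [r], but [G] is uniformly close on nearby fibers: evaluating each
    fiber at the other's maximizer bounds the difference of the maxima. In polar coordinates [m r]
    becomes a maximum over the circle of radius [r]. *)
Lemma fiber_max_continuous (G : R -> R -> R) (a b : R) :
  a <= b -> (forall r t, continuity_2d_pt G r t) ->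
  exists m : R -> R,
    (forall r t, a <= t <= b -> G r t <= m r) /\
    (forall r, exists t, a <= t <= b /\ m r = G r t) /\
    forall r, continuous m r.
Proof.
intros Hab HG.
assert (Hex : forall r, exists t, (forall c, a <= c <= b -> G r c <= G r t) /\ a <= t <= b).
{ intros r; apply (continuity_ab_maj (G r)); [exact Hab|].
  intros c _; apply continuity_pt_filterlim.
  apply (continuity_2d_pt_section2 G), HG. }
destruct (choice _ Hex) as [t Ht].
exists (fun r => G r (t r)); split; [|split].
- intros r s Hs; now apply Ht.
- intros r; exists (t r); split; [apply Ht | reflexivity].
- intros r; apply continuity_pt_filterlim; intros eps Heps.
  destruct (uniform_continuity_2d_1d' G a b r (fun x _ => HG r x) (mkposreal eps Heps))
    as [d Hd]; simpl in Hd.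
  exists d; split; [apply cond_pos|].
  intros s [_ Hs]; simpl in *; unfold Rdist in *.
  assert (Hp := cond_pos d).
  assert (HU : forall x, a <= x <= b -> Rabs (G s x - G r x) < eps).
  { apply Rabs_def2 in Hs.
    intros x Hx; apply Hd; try lra.
    rewrite Rminus_eq_0, Rabs_R0; lra. }
  destruct (Ht s) as [Hs1 Hs2]; destruct (Ht r) as [Hr1 Hr2].
  assert (A1 := HU _ Hs2); assert (A2 := HU _ Hr2).
  apply Rabs_def2 in A1; apply Rabs_def2 in A2.
  specialize (Hs1 _ Hr2); specialize (Hr1 _ Hs2).
  apply Rabs_def1; lra.
Qed.

(** * Goursat's lemma *)

(** The integral of the form [p dx + q dy] along the boundary of a rectangle, counterclockwise when
    [a <= b] and [c <= d]. *)
Definition rect_circulation (p q : R -> R -> R) (a b c d : R) : R :=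
  (RInt (fun x => p x c) a b - RInt (fun x => p x d) a b) +
  (RInt (fun y => q b y) c d - RInt (fun y => q a y) c d).

Lemma RInt_near_const (g : R -> R) (a b k e : R) :
  a <= b -> (forall x, continuous g x) ->
  (forall x, a <= x <= b -> Rabs (g x - k) <= e) ->
  Rabs (RInt g a b - k * (b - a)) <= (b - a) * e.
Proof.
intros Hab Hg He.
assert (Hi : ex_RInt g a b) by (apply (ex_RInt_continuous (V := R_CompleteNormedModule)); auto).
replace (RInt g a b - k * (b - a)) with (RInt (fun x => g x - k) a b).
- apply abs_RInt_le_const; auto.
  apply (ex_RInt_minus (V := R_NormedModule)); [exact Hi | apply ex_RInt_const].
- rewrite (RInt_minus (V := R_CompleteNormedModule)); [|exact Hi | apply ex_RInt_const].
  rewrite RInt_const; unfold minus, plus, opp, scal; simpl; unfold mult; simpl; ring.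
Qed.

Lemma RInt_Chasles_R (g : R -> R) (a b c : R) : ex_RInt g a b -> ex_RInt g b c ->
  RInt g a b + RInt g b c = RInt g a c.
Proof. exact (RInt_Chasles (V := R_CompleteNormedModule) g a b c). Qed.

Lemma nested_intervals (a b : nat -> R) :
  (forall n, a n <= a (S n)) -> (forall n, b (S n) <= b n) -> (forall n, a n <= b n) ->
  exists X, forall n, a n <= X <= b n.
Proof.
intros Ha Hb Hab.
assert (Hai : forall n k, a n <= a (k + n)%nat).
{ intros n k; induction k; simpl; [lra | eapply Rle_trans; [exact IHk | apply Ha]]. }
assert (Hbi : forall n k, b (k + n)%nat <= b n).
{ intros n k; induction k; simpl; [lra | eapply Rle_trans; [apply Hb | exact IHk]]. }
assert (Hc : forall n m, a n <= b m).
{ intros n m.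
  apply Rle_trans with (a (m + n)%nat); [apply Hai|].
  apply Rle_trans with (b (m + n)%nat); [apply Hab|].
  rewrite Nat.add_comm; apply Hbi. }
destruct (completeness (fun x => exists n, x = a n)) as [X [HX1 HX2]].
- exists (b O); intros x [n ->]; apply Hc.
- exists (a O); now exists O.
- exists X; intros n; split; [apply HX1; now exists n|].
  apply HX2; intros x [k ->]; apply Hc.
Qed.

Section Goursat.
(** The shared [p2] below says that [p dx + q dy] is closed. The partial derivatives need not be
    continuous, hence bisection rather than Green's formula. *)
Variables p q p1 p2 q2 : R -> R -> R.
Hypothesis Dp : forall x y, differentiable_pt_lim p x y (p1 x y) (p2 x y).
Hypothesis Dq : forall x y, differentiable_pt_lim q x y (p2 x y) (q2 x y).

Let Cp1 x y : continuous (fun t => p t y) x.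
Proof. eapply continuity_2d_pt_section1, differentiable_pt_lim_continuity, Dp. Qed.
Let Cq2 x y : continuous (fun t => q x t) y.
Proof. eapply continuity_2d_pt_section2, differentiable_pt_lim_continuity, Dq. Qed.

Let Ip a b y : ex_RInt (fun t => p t y) a b.
Proof. apply (ex_RInt_continuous (V := R_CompleteNormedModule)); auto. Qed.
Let Iq a b x : ex_RInt (fun t => q x t) a b.
Proof. apply (ex_RInt_continuous (V := R_CompleteNormedModule)); auto. Qed.

Lemma rect_circulation_split1 (m a b c d : R) :
  rect_circulation p q a b c d =
  rect_circulation p q a m c d + rect_circulation p q m b c d.
Proof.
unfold rect_circulation.
rewrite <- (RInt_Chasles_R (fun x => p x c) a m b), <- (RInt_Chasles_R (fun x => p x d) a m b)
  by apply Ip.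
ring.
Qed.

Lemma rect_circulation_split2 (m a b c d : R) :
  rect_circulation p q a b c d =
  rect_circulation p q a b c m + rect_circulation p q a b m d.
Proof.
unfold rect_circulation.
rewrite <- (RInt_Chasles_R (fun y => q b y) c m d), <- (RInt_Chasles_R (fun y => q a y) c m d)
  by apply Iq.
ring.
Qed.

(** The affine parts of [p] and [q] at [(X, Y)] have zero circulation, because both cross terms
    carry [p2 X Y]. What remains is a first-order error integrated over sides of total length
    comparable to [S]. *)
Lemma rect_circulation_local (X Y e : R) : 0 < e ->
  exists del, 0 < del /\ forall a b c d, a <= X <= b -> c <= Y <= d ->
    b - a < del -> d - c < del ->
    Rabs (rect_circulation p q a b c d) <= e * ((b - a) + (d - c)) ^ 2.
Proof.
intros He.
assert (He2 : 0 < e / 4) by lra.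
destruct (Dp X Y (mkposreal _ He2)) as [d1 H1].
destruct (Dq X Y (mkposreal _ He2)) as [d2 H2]; simpl in *.
exists (Rmin d1 d2); split; [apply Rmin_pos; apply cond_pos|].
intros a b c d Ha Hc Hl Hh.
assert (M1 := Rmin_l d1 d2); assert (M2 := Rmin_r d1 d2).
set (S := (b - a) + (d - c)).
assert (Hmax : forall x y, a <= x <= b -> c <= y <= d ->
  Rmax (Rabs (x - X)) (Rabs (y - Y)) <= S).
{ intros x y Hx Hy; unfold S; apply Rmax_lub; apply Rabs_le; lra. }
assert (E1 : forall x y, a <= x <= b -> c <= y <= d ->
  Rabs (p x y - p X Y - (p1 X Y * (x - X) + p2 X Y * (y - Y))) <= e / 4 * S).
{ intros x y Hx Hy; eapply Rle_trans; [apply H1; apply Rabs_def1; lra|].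
  apply Rmult_le_compat_l; [lra | auto]. }
assert (E2 : forall x y, a <= x <= b -> c <= y <= d ->
  Rabs (q x y - q X Y - (p2 X Y * (x - X) + q2 X Y * (y - Y))) <= e / 4 * S).
{ intros x y Hx Hy; eapply Rle_trans; [apply H2; apply Rabs_def1; lra|].
  apply Rmult_le_compat_l; [lra | auto]. }
assert (B1 : Rabs (RInt (fun x => p x c - p x d) a b - p2 X Y * (c - d) * (b - a))
  <= (b - a) * (e / 2 * S)).
{ apply RInt_near_const; [lra | |].
  - intros x; apply (continuous_minus (V := R_NormedModule)); apply Cp1.
  - intros x Hx. assert (F1 := E1 x c Hx ltac:(lra)); assert (F2 := E1 x d Hx ltac:(lra)).
    apply Rabs_le_between in F1; apply Rabs_le_between in F2; apply Rabs_le_between. lra. }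
assert (B2 : Rabs (RInt (fun y => q b y - q a y) c d - p2 X Y * (b - a) * (d - c))
  <= (d - c) * (e / 2 * S)).
{ apply RInt_near_const; [lra | |].
  - intros x; apply (continuous_minus (V := R_NormedModule)); apply Cq2.
  - intros y Hy. assert (F1 := E2 b y ltac:(lra) Hy); assert (F2 := E2 a y ltac:(lra) Hy).
    apply Rabs_le_between in F1; apply Rabs_le_between in F2; apply Rabs_le_between. lra. }
rewrite (RInt_minus (V := R_CompleteNormedModule)) in B1 by apply Ip.
rewrite (RInt_minus (V := R_CompleteNormedModule)) in B2 by apply Iq.
unfold minus, plus, opp in B1, B2; simpl in B1, B2.
unfold rect_circulation.
apply Rabs_le_between in B1; apply Rabs_le_between in B2; apply Rabs_le_between.
assert (HS : (b - a) * (e / 2 * S) + (d - c) * (e / 2 * S) = e / 2 * S ^ 2) by (unfold S; ring).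
assert (0 <= S ^ 2) by apply pow2_ge_0.
fold S.
assert (HZ : p2 X Y * (c - d) * (b - a) + p2 X Y * (b - a) * (d - c) = 0) by ring.
assert (He' : 0 <= e * S ^ 2) by (apply Rmult_le_pos; lra).
change (fun y => q b y) with (q b); change (fun y => q a y) with (q a).
split; lra.
Qed.

Definition quarter_spec (a b c d a' b' c' d' : R) : Prop :=
  a <= a' /\ b' <= b /\ c <= c' /\ d' <= d /\ b' - a' = (b - a) / 2 /\ d' - c' = (d - c) / 2 /\
  Rabs (rect_circulation p q a b c d) <= 4 * Rabs (rect_circulation p q a' b' c' d').

(** The circulations of the four quarters add up to the whole, so one of them carries at least a
    fourth of it in absolute value. *)
Lemma rect_circulation_quarter (a b c d : R) : a <= b -> c <= d ->
  exists Q : (R * R) * (R * R),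
    quarter_spec a b c d (fst (fst Q)) (snd (fst Q)) (fst (snd Q)) (snd (snd Q)).
Proof.
intros Hab Hcd.
set (m := (a + b) / 2); set (n := (c + d) / 2).
assert (E : rect_circulation p q a b c d =
  rect_circulation p q a m c n + rect_circulation p q a m n d +
  (rect_circulation p q m b c n + rect_circulation p q m b n d)).
{ rewrite (rect_circulation_split1 m), (rect_circulation_split2 n a m),
    (rect_circulation_split2 n m b); ring. }
set (T := Rabs (rect_circulation p q a b c d)).
assert (HT : T <= Rabs (rect_circulation p q a m c n) + Rabs (rect_circulation p q a m n d) +
  (Rabs (rect_circulation p q m b c n) + Rabs (rect_circulation p q m b n d))).
{ unfold T; rewrite E.
  eapply Rle_trans; [apply Rabs_triang|]; apply Rplus_le_compat; apply Rabs_triang. }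
unfold quarter_spec; fold T.
destruct (Rle_lt_dec T (4 * Rabs (rect_circulation p q a m c n)));
  [exists ((a, m), (c, n)) | ].
{ simpl; unfold m, n in *; repeat split; lra. }
destruct (Rle_lt_dec T (4 * Rabs (rect_circulation p q a m n d)));
  [exists ((a, m), (n, d)) | ].
{ simpl; unfold m, n in *; repeat split; lra. }
destruct (Rle_lt_dec T (4 * Rabs (rect_circulation p q m b c n)));
  [exists ((m, b), (c, n)) | exists ((m, b), (n, d))];
  simpl; unfold m, n in *; repeat split; lra.
Qed.

(** After [n] bisections the circulation is at least [|T| / 4^n], while the local estimate at the
    common point bounds it by [e * L^2 / 4^n]; a small [e] is contradictory unless [T = 0]. *)
Lemma goursat_ordered (a b c d : R) : a <= b -> c <= d -> rect_circulation p q a b c d = 0.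
Proof.
intros Hab Hcd.
(* The order conditions sit under the existential so that [choice] yields a total function;
   ill-ordered rectangles get a dummy successor. *)
assert (Hstep : forall Q : (R * R) * (R * R), exists Q' : (R * R) * (R * R),
  fst (fst Q) <= snd (fst Q) -> fst (snd Q) <= snd (snd Q) ->
  quarter_spec (fst (fst Q)) (snd (fst Q)) (fst (snd Q)) (snd (snd Q))
    (fst (fst Q')) (snd (fst Q')) (fst (snd Q')) (snd (snd Q'))).
{ intros [[x x'] [y y']]; simpl.
  destruct (Rle_lt_dec x x') as [H|H]; [|exists ((0,0),(0,0)); lra].
  destruct (Rle_lt_dec y y') as [H'|H']; [|exists ((0,0),(0,0)); lra].
  destruct (rect_circulation_quarter x x' y y' H H') as [Q HQ]; now exists Q. }
destruct (choice _ Hstep) as [next Hnext].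
set (Q n := Nat.iter n next ((a, b), (c, d))).
set (T := rect_circulation p q a b c d).
assert (HQ : forall n,
  snd (fst (Q n)) - fst (fst (Q n)) = (b - a) / 2 ^ n /\
  snd (snd (Q n)) - fst (snd (Q n)) = (d - c) / 2 ^ n /\
  Rabs T <= 4 ^ n *
    Rabs (rect_circulation p q (fst (fst (Q n))) (snd (fst (Q n)))
      (fst (snd (Q n))) (snd (snd (Q n))))).
{ induction n as [|n IH]; [simpl; unfold T; lra|].
  destruct IH as [I1 [I2 I3]].
  assert (P2 : 0 < 2 ^ n) by (apply pow_lt; lra).
  assert (P4 : 0 < 4 ^ n) by (apply pow_lt; lra).
  assert (0 <= (b - a) / 2 ^ n) by (apply Rmult_le_pos; [lra | left; now apply Rinv_0_lt_compat]).
  assert (0 <= (d - c) / 2 ^ n) by (apply Rmult_le_pos; [lra | left; now apply Rinv_0_lt_compat]).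
  destruct (Hnext (Q n)) as [_ [_ [_ [_ [N1 [N2 N3]]]]]]; [lra | lra |].
  change (Q (S n)) with (next (Q n)).
  split; [rewrite N1, I1; simpl; field; lra|].
  split; [rewrite N2, I2; simpl; field; lra|].
  eapply Rle_trans; [exact I3|].
  simpl pow; rewrite (Rmult_comm 4), Rmult_assoc.
  apply Rmult_le_compat_l; lra. }
assert (Hord : forall n, fst (fst (Q n)) <= snd (fst (Q n)) /\ fst (snd (Q n)) <= snd (snd (Q n))).
{ intros n; destruct (HQ n) as [I1 [I2 _]].
  assert (P2 : 0 < 2 ^ n) by (apply pow_lt; lra).
  assert (0 <= (b - a) / 2 ^ n) by (apply Rmult_le_pos; [lra | left; now apply Rinv_0_lt_compat]).
  assert (0 <= (d - c) / 2 ^ n) by (apply Rmult_le_pos; [lra | left; now apply Rinv_0_lt_compat]).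
  lra. }
assert (Hn : forall n, quarter_spec _ _ _ _ _ _ _ _) by
  (intros n; exact (Hnext (Q n) (proj1 (Hord n)) (proj2 (Hord n)))).
destruct (nested_intervals (fun n => fst (fst (Q n))) (fun n => snd (fst (Q n)))) as [X HX].
1,2: intros n; apply (Hn n).
1: intros n; apply (Hord n).
destruct (nested_intervals (fun n => fst (snd (Q n))) (fun n => snd (snd (Q n)))) as [Y HY].
1,2: intros n; apply (Hn n).
1: intros n; apply (Hord n).
destruct (Req_dec T 0) as [|HT]; [assumption | exfalso].
apply Rabs_pos_lt in HT.
set (L := (b - a) + (d - c)).
assert (HL : 0 <= L) by (unfold L; lra).
assert (HL2 : 0 < L ^ 2 + 1) by nra.
(* This makes [e * L ^ 2] smaller than [Rabs T]; the [+ 1] covers degenerate rectangles with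
   [L = 0]. *)
set (e := Rabs T / 2 / (L ^ 2 + 1)).
assert (He : 0 < e) by (apply Rdiv_lt_0_compat; lra).
destruct (rect_circulation_local X Y e He) as [del [Hdel Hloc]].
destruct (pow_lt_1_zero (/ 2)) with (y := del / (L + 1)) as [N HN].
{ rewrite Rabs_right; lra. }
{ apply Rdiv_lt_0_compat; lra. }
specialize (HN N (le_n _)).
assert (P2 : 0 < (/ 2) ^ N) by (apply pow_lt; lra).
rewrite Rabs_right in HN by lra.
assert (HN' : L * (/ 2) ^ N < del).
{ apply Rle_lt_trans with ((L + 1) * (/2) ^ N); [nra|].
  apply Rmult_lt_reg_l with (/ (L + 1)); [apply Rinv_0_lt_compat; lra|].
  rewrite <- Rmult_assoc, Rinv_l, Rmult_1_l by lra. unfold Rdiv in HN; lra. }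
destruct (HQ N) as [I1 [I2 I3]].
unfold Rdiv in I1, I2; rewrite <- pow_inv in I1, I2.
assert (F := Hloc _ _ _ _ (HX N) (HY N)).
rewrite I1, I2 in F.
assert (F' := F ltac:(unfold L in HN'; nra) ltac:(unfold L in HN'; nra)).
replace (((b - a) * (/ 2) ^ N + (d - c) * (/ 2) ^ N) ^ 2) with (L ^ 2 * ((/ 2) ^ N) ^ 2) in F'
  by (unfold L; ring).
assert (P4 : 4 ^ N * ((/ 2) ^ N) ^ 2 = 1).
{ rewrite <- pow_mult, Nat.mul_comm, pow_mult, <- Rpow_mult_distr.
  replace (4 * (/ 2) ^ 2) with 1 by field; apply pow1. }
assert (Rabs T <= e * L ^ 2).
{ eapply Rle_trans; [exact I3|].
  replace (e * L ^ 2) with (4 ^ N * (e * (L ^ 2 * ((/ 2) ^ N) ^ 2))).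
  - apply Rmult_le_compat_l; [apply pow_le; lra | exact F'].
  - transitivity (e * L ^ 2 * (4 ^ N * ((/ 2) ^ N) ^ 2)); [ring | rewrite P4; ring]. }
assert (e * (L ^ 2 + 1) = Rabs T / 2) by (unfold e; field; lra).
nra.
Qed.

Lemma rect_circulation_swap1 (a b c d : R) :
  rect_circulation p q b a c d = - rect_circulation p q a b c d.
Proof.
assert (H := rect_circulation_split1 b a a c d).
unfold rect_circulation in *; rewrite !RInt_point in H; unfold zero in H; simpl in H; lra.
Qed.

Lemma rect_circulation_swap2 (a b c d : R) :
  rect_circulation p q a b d c = - rect_circulation p q a b c d.
Proof.
assert (H := rect_circulation_split2 d a b c c).
unfold rect_circulation in *; rewrite !RInt_point in H; unfold zero in H; simpl in H; lra.
Qed.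

(** All orientations are covered because the primitive below uses rectangles with one corner at the
    origin and the opposite corner anywhere. *)
Lemma goursat (a b c d : R) : rect_circulation p q a b c d = 0.
Proof.
destruct (Rle_lt_dec a b) as [Hab|Hab]; destruct (Rle_lt_dec c d) as [Hcd|Hcd].
- now apply goursat_ordered.
- rewrite rect_circulation_swap2, goursat_ordered; lra.
- rewrite rect_circulation_swap1, goursat_ordered; lra.
- rewrite rect_circulation_swap1, rect_circulation_swap2, goursat_ordered; lra.
Qed.

(** Integrate along the horizontal axis, then vertically: the [y]-derivative is immediate. By
    Goursat the path that goes vertically first gives the same value, and this yields the
    [x]-derivative. *)
Lemma primitive_exists : exists P : R -> R -> R,
  (forall x y, is_derive (fun t => P t y) x (p x y)) /\
  (forall x y, is_derive (fun t => P x t) y (q x y)).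
Proof.
exists (fun x y => RInt (fun t => p t 0) 0 x + RInt (fun t => q x t) 0 y).
assert (FTC : forall (g : R -> R) a, (forall t, continuous g t) ->
  forall x, is_derive (fun t => RInt g a t) x (g x)).
{ intros g a Hg x; apply (is_derive_RInt (V := R_NormedModule) g _ a); [|apply Hg].
  apply filter_forall; intros t; apply (RInt_correct (V := R_CompleteNormedModule)).
  apply (ex_RInt_continuous (V := R_CompleteNormedModule)); auto. }
split; intros x y.
- apply is_derive_ext with (fun t => RInt (fun s => q 0 s) 0 y + RInt (fun s => p s y) 0 t).
  { intros t; assert (H := goursat 0 t 0 y); unfold rect_circulation in H; lra. }
  rewrite <- (Rplus_0_l (p x y)).
  apply (is_derive_plus (V := R_NormedModule)); [apply @is_derive_const|].
  apply (FTC (fun s => p s y)); auto.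
- rewrite <- (Rplus_0_l (q x y)).
  apply (is_derive_plus (V := R_NormedModule)); [apply @is_derive_const|].
  apply (FTC (fun s => q x s)); auto.
Qed.

End Goursat.

(** * The maximum principle for twice differentiable harmonic functions *)

(** If [l] were positive, [dg], which vanishes at [x], would be positive just to the right of [x],
    and the mean value theorem would push [g] above [g x]. *)
Lemma second_derivative_at_max (g dg : R -> R) (x l d : R) :
  (forall t, is_derive g t (dg t)) -> is_derive dg x l -> 0 < d ->
  (forall t, Rabs (t - x) < d -> g t <= g x) -> l <= 0.
Proof.
intros Hg Hdg Hd Hmax.
assert (Hz : dg x = 0).
{ assert (pr : derivable_pt g x) by (exists (dg x); apply is_derive_Reals, Hg).
  rewrite <- (is_derive_unique _ _ _ (Hg x)), <- (Derive_Reals g x pr).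
  apply (deriv_maximum g (x - d) (x + d)); try lra.
  intros t Ht1 Ht2; apply Hmax, Rabs_def1; lra. }
destruct (Rle_lt_dec l 0) as [|Hl]; [assumption | exfalso].
apply is_derive_Reals in Hdg.
destruct (Hdg l Hl) as [d' Hd'].
set (h := Rmin d d' / 2).
assert (Hm : 0 < Rmin d d') by (apply Rmin_pos; [lra | apply cond_pos]).
assert (M1 := Rmin_l d d'); assert (M2 := Rmin_r d d').
destruct (MVT_cor2 g dg x (x + h)) as [c [E Hc]]; [unfold h; lra | |].
{ intros; apply is_derive_Reals, Hg. }
assert (Hx := Hmax (x + h) ltac:(unfold h; apply Rabs_def1; lra)).
assert (Hpos : 0 < dg c).
{ specialize (Hd' (c - x) ltac:(lra) ltac:(unfold h in Hc; apply Rabs_def1; lra)).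
  replace (x + (c - x)) with c in Hd' by ring.
  rewrite Hz in Hd'; apply Rabs_def2 in Hd'.
  assert (0 < (dg c - 0) / (c - x)) by lra.
  replace (dg c) with ((dg c - 0) / (c - x) * (c - x)) by (field; lra).
  apply Rmult_lt_0_compat; lra. }
assert (0 < dg c * (x + h - x)) by (apply Rmult_lt_0_compat; unfold h in *; lra).
lra.
Qed.

Lemma circle_param (x y r : R) : 0 <= r -> x ^ 2 + y ^ 2 = r ^ 2 ->
  exists t, - PI <= t <= PI /\ x = r * cos t /\ y = r * sin t.
Proof.
intros Hr E.
destruct (Req_dec r 0) as [->|Hr0].
{ exists 0; assert (H := PI_RGT_0); assert (x = 0) by nra; assert (y = 0) by nra; lra. }
assert (Hx : -1 <= x / r <= 1).
{ split; apply Rmult_le_reg_r with r; try lra; unfold Rdiv;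
    rewrite Rmult_assoc, Rinv_l by lra; nra. }
assert (B := acos_bound (x / r)).
assert (C := cos_acos _ Hx).
assert (S := sin_acos _ Hx).
assert (Sy : r * sqrt (1 - (x / r)²) = Rabs y).
{ rewrite <- (sqrt_Rsqr r) at 1 by lra.
  rewrite <- sqrt_mult_alt by apply Rle_0_sqr.
  rewrite <- sqrt_Rsqr_abs; f_equal; unfold Rsqr.
  replace (r * r * (1 - x / r * (x / r))) with (r ^ 2 - x ^ 2) by (field; lra).
  lra. }
destruct (Rle_lt_dec 0 y).
- exists (acos (x / r)); rewrite C, S, Sy, Rabs_right by lra.
  split; [lra|]; split; [field; lra | reflexivity].
- exists (- acos (x / r)); rewrite cos_neg, sin_neg, C, S, Ropp_mult_distr_r_reverse, Sy, Rabs_left by lra.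
  split; [lra|]; split; [field; lra | ring].
Qed.

Lemma circle_param_norm (r t : R) : (r * cos t) ^ 2 + (r * sin t) ^ 2 = r ^ 2.
Proof.
assert (H := sin2_cos2 t); unfold Rsqr in H.
replace ((r * cos t) ^ 2 + (r * sin t) ^ 2) with (r ^ 2 * (sin t * sin t + cos t * cos t)) by ring.
rewrite H; ring.
Qed.

Lemma continuity_2d_pt_of_fst (g : R -> R) (r t : R) : continuity_pt g r ->
  continuity_2d_pt (fun u _ => g u) r t.
Proof.
intros Hg; apply (continuity_1d_2d_pt_comp g (fun u _ => u)); [exact Hg | apply continuity_2d_pt_id1].
Qed.

Lemma continuity_2d_pt_of_snd (g : R -> R) (r t : R) : continuity_pt g t ->
  continuity_2d_pt (fun _ u => g u) r t.
Proof.
intros Hg; apply (continuity_1d_2d_pt_comp g (fun _ u => u)); [exact Hg | apply continuity_2d_pt_id2].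
Qed.

Lemma polar_continuity (E : R -> R -> R) : (forall x y, continuity_2d_pt E x y) ->
  forall r t, continuity_2d_pt (fun r t => E (r * cos t) (r * sin t)) r t.
Proof.
intros HE r t; apply continuity_2d_pt_comp; [apply HE | |];
  apply continuity_2d_pt_mult; try apply continuity_2d_pt_id1;
  apply continuity_2d_pt_of_snd; [apply continuity_cos | apply continuity_sin].
Qed.

(** Maximize over each circle first, then over the radius in [[0, r]]. *)
Lemma max_on_disc (E : R -> R -> R) (r : R) : 0 <= r ->
  (forall x y, continuity_2d_pt E x y) ->
  exists x0 y0, x0 ^ 2 + y0 ^ 2 <= r ^ 2 /\
    forall x y, x ^ 2 + y ^ 2 <= r ^ 2 -> E x y <= E x0 y0.
Proof.
intros Hr HE.
assert (HPI := PI_RGT_0).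
destruct (fiber_max_continuous _ (- PI) PI ltac:(lra) (polar_continuity E HE))
  as [m [Hm1 [Hm2 Hm3]]].
destruct (continuity_ab_maj m 0 r Hr) as [s [Hs1 Hs2]].
{ intros c _; apply continuity_pt_filterlim, Hm3. }
destruct (Hm2 s) as [t [_ Ht]].
exists (s * cos t), (s * sin t); split.
{ rewrite circle_param_norm; apply pow_incr; lra. }
intros x y Hxy; rewrite <- Ht.
set (n := sqrt (x ^ 2 + y ^ 2)).
assert (Hxy0 : 0 <= x ^ 2 + y ^ 2) by nra.
assert (Hn : n ^ 2 = x ^ 2 + y ^ 2) by (unfold n; now rewrite pow2_sqrt).
assert (Hn0 : 0 <= n) by apply sqrt_pos.
destruct (circle_param x y n Hn0 (eq_sym Hn)) as [t' [Ht' [Ex Ey]]].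
rewrite Ex, Ey; eapply Rle_trans; [apply (Hm1 n t' Ht') | apply Hs1].
split; [exact Hn0 | nra].
Qed.

(** Adding [e * (x^2 + y^2)] makes the Laplacian equal to [4 * e > 0]. For small [e] the perturbed
    function still has its maximum inside the disc, where both second derivatives are at most 0. *)
Lemma harmonic_max_principle (D D1 D2 L1 L2 : R -> R -> R) (r B : R) :
  0 <= r ->
  (forall x y, continuity_2d_pt D x y) ->
  (forall x y, is_derive (fun t => D t y) x (D1 x y)) ->
  (forall x y, is_derive (fun t => D x t) y (D2 x y)) ->
  (forall x y, is_derive (fun t => D1 t y) x (L1 x y)) ->
  (forall x y, is_derive (fun t => D2 x t) y (L2 x y)) ->
  (forall x y, L1 x y + L2 x y = 0) ->
  (forall x y, x ^ 2 + y ^ 2 = r ^ 2 -> D x y <= B) ->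
  forall x y, x ^ 2 + y ^ 2 <= r ^ 2 -> D x y <= B.
Proof.
intros Hr HD H1 H2 H11 H22 HL HB x y Hxy.
destruct (Rle_lt_dec (D x y) B) as [|Hlt]; [assumption | exfalso].
(* Small enough that on the circle the perturbation cannot make up the gap [D x y - B]; the [+ 1]
   allows [r = 0]. *)
set (e := (D x y - B) / (r ^ 2 + 1)).
assert (Hr2 : 0 <= r ^ 2) by apply pow2_ge_0.
assert (He : 0 < e) by (apply Rdiv_lt_0_compat; lra).
assert (Her : B + e * r ^ 2 < D x y).
{ assert (e * (r ^ 2 + 1) = D x y - B) by (unfold e; field; lra). lra. }
destruct (max_on_disc (fun x y => D x y + e * (x ^ 2 + y ^ 2)) r Hr) as [a [b [Hab Hmax]]].
{ intros u v; apply continuity_2d_pt_plus; [apply HD|].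
  apply continuity_2d_pt_mult; [apply continuity_2d_pt_const|].
  apply continuity_2d_pt_plus; [apply (continuity_2d_pt_of_fst (fun t => t ^ 2)) |
    apply (continuity_2d_pt_of_snd (fun t => t ^ 2))]; apply derivable_continuous_pt; reg. }
assert (Hin : a ^ 2 + b ^ 2 < r ^ 2).
{ destruct (Req_dec (a ^ 2 + b ^ 2) (r ^ 2)) as [E|]; [exfalso | lra].
  assert (F := Hmax x y Hxy); simpl in F.
  assert (F' := HB a b E).
  assert (0 <= e * (x ^ 2 + y ^ 2)) by (apply Rmult_le_pos; nra).
  cbv beta in F; simpl pow in *. nra. }
assert (HP : continuity_pt (fun t => t ^ 2 + b ^ 2) a) by (apply derivable_continuous_pt; reg).
assert (HQ : continuity_pt (fun t => a ^ 2 + t ^ 2) b) by (apply derivable_continuous_pt; reg).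
assert (Hgap : 0 < r ^ 2 - (a ^ 2 + b ^ 2)) by lra.
destruct (proj1 (continuity_pt_locally _ _) HP (mkposreal _ Hgap)) as [d1 Hd1].
destruct (proj1 (continuity_pt_locally _ _) HQ (mkposreal _ Hgap)) as [d2 Hd2].
simpl in Hd1, Hd2.
assert (E1 : L1 a b + 2 * e <= 0).
{ apply (second_derivative_at_max (fun t => D t b + e * (t ^ 2 + b ^ 2))
    (fun t => D1 t b + 2 * e * t) a _ d1).
  - intros t; auto_derive; [eexists; apply H1 |].
    replace (Derive (fun x0 : R => D x0 b) t) with (D1 t b)
      by (symmetry; apply is_derive_unique, H1); ring.
  - auto_derive; [eexists; apply H11 |].
    replace (Derive (fun x0 : R => D1 x0 b) a) with (L1 a b)
      by (symmetry; apply is_derive_unique, H11); ring.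
  - apply cond_pos.
  - intros t Ht; apply Hmax.
    specialize (Hd1 t Ht); apply Rabs_def2 in Hd1; simpl pow in *; lra. }
assert (E2 : L2 a b + 2 * e <= 0).
{ apply (second_derivative_at_max (fun t => D a t + e * (a ^ 2 + t ^ 2))
    (fun t => D2 a t + 2 * e * t) b _ d2).
  - intros t; auto_derive; [eexists; apply H2 |].
    replace (Derive (fun x0 : R => D a x0) t) with (D2 a t)
      by (symmetry; apply is_derive_unique, H2); ring.
  - auto_derive; [eexists; apply H22 |].
    replace (Derive (fun x0 : R => D2 a x0) b) with (L2 a b)
      by (symmetry; apply is_derive_unique, H22); ring.
  - apply cond_pos.
  - intros t Ht; apply Hmax.
    specialize (Hd2 t Ht); apply Rabs_def2 in Hd2; simpl pow in *; lra. }
specialize (HL a b); lra.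
Qed.

(** * Complex differentiability *)

Definition Ccontinuous (h : C -> C) (a : C) : Prop :=
  forall e, 0 < e -> exists d, 0 < d /\ forall z, Cmod (z - a) < d -> Cmod (h z - h a) < e.

Lemma Ccontinuous_ext_loc (g h : C -> C) (a : C) (d : R) : 0 < d ->
  (forall z, Cmod (z - a) < d -> g z = h z) -> Ccontinuous g a -> Ccontinuous h a.
Proof.
intros Hd E Hg e He; destruct (Hg e He) as [d' [Hd' H]].
exists (Rmin d d'); split; [now apply Rmin_pos|].
intros z Hz.
assert (M1 := Rmin_l d d'); assert (M2 := Rmin_r d d').
rewrite <- !E; [apply H; lra | | lra].
unfold Cminus; rewrite Cplus_opp_r, Cmod_0; exact Hd.
Qed.

(** The uniform structure is the one whose balls are given by [Cmod]; the bridge brings in the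
    library's sum and product rules. *)
Lemma CcontinuousP (h : C -> C) (a : C) :
  Ccontinuous h a <->
  continuous (T := AbsRing_UniformSpace C_AbsRing) (U := AbsRing_UniformSpace C_AbsRing) h a.
Proof.
split.
- intros H; apply filterlim_locally; intros [e He].
  destruct (H e He) as [d [Hd Hz]]; exists (mkposreal d Hd); exact Hz.
- intros H e He.
  destruct (proj1 (filterlim_locally _ _) H (mkposreal e He)) as [d Hd].
  exists d; split; [apply cond_pos | exact Hd].
Qed.

Lemma Ccontinuous_const (c a : C) : Ccontinuous (fun _ => c) a.
Proof.
intros e He; exists 1; split; [lra|]; intros z _.
unfold Cminus; rewrite Cplus_opp_r, Cmod_0; exact He.
Qed.

Lemma Ccontinuous_id (a : C) : Ccontinuous (fun z => z) a.
Proof. intros e He; exists e; split; [exact He | auto]. Qed.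

Lemma Ccontinuous_plus (g h : C -> C) (a : C) :
  Ccontinuous g a -> Ccontinuous h a -> Ccontinuous (fun z => g z + h z)%C a.
Proof.
rewrite !CcontinuousP.
exact (@continuous_plus (AbsRing_UniformSpace C_AbsRing) C_AbsRing
  (AbsRing_NormedModule C_AbsRing) g h a).
Qed.

Lemma Ccontinuous_mult (g h : C -> C) (a : C) :
  Ccontinuous g a -> Ccontinuous h a -> Ccontinuous (fun z => g z * h z)%C a.
Proof.
rewrite !CcontinuousP.
exact (@continuous_mult (AbsRing_UniformSpace C_AbsRing) C_AbsRing g h a).
Qed.

Lemma Cmod_minus_sym (a b : C) : Cmod (a - b) = Cmod (b - a).
Proof. rewrite <- Cmod_opp; f_equal; ring. Qed.

Lemma Cmod_minus_triangle (a b : C) : Cmod a - Cmod b <= Cmod (a - b).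
Proof.
assert (H := Cmod_triangle (a - b) b).
replace (a - b + b)%C with a in H by ring; lra.
Qed.

Lemma Ccontinuous_inv (a : C) : a <> 0%C -> Ccontinuous Cinv a.
Proof.
intros Ha e He.
assert (Hm := proj1 (Cmod_gt_0 a) Ha).
exists (Rmin (Cmod a / 2) (e * (Cmod a * Cmod a / 2))); split.
{ apply Rmin_pos; [lra|]; apply Rmult_lt_0_compat; [lra|].
  assert (0 < Cmod a * Cmod a) by now apply Rmult_lt_0_compat. lra. }
intros z Hz.
assert (M1 := Rmin_l (Cmod a / 2) (e * (Cmod a * Cmod a / 2))).
assert (M2 := Rmin_r (Cmod a / 2) (e * (Cmod a * Cmod a / 2))).
assert (T := Cmod_minus_triangle a z); rewrite Cmod_minus_sym in T.
assert (Hz0 : Cmod a / 2 < Cmod z) by lra.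
assert (Hzn : z <> 0%C) by (apply Cmod_gt_0; lra).
replace (/ z - / a)%C with ((a - z) * / (z * a))%C by (field; now split).
rewrite Cmod_mult, Cmod_inv, Cmod_mult by (apply Cmult_neq_0; assumption).
rewrite Cmod_minus_sym.
assert (P : Cmod a * Cmod a / 2 < Cmod z * Cmod a) by nra.
assert (P0 : 0 < Cmod z * Cmod a) by (apply Rmult_lt_0_compat; lra).
apply Rmult_lt_reg_r with (Cmod z * Cmod a); [exact P0|].
rewrite Rmult_assoc, Rinv_l by lra.
assert (e * (Cmod a * Cmod a / 2) < e * (Cmod z * Cmod a)) by now apply Rmult_lt_compat_l.
lra.
Qed.

(* Caratheodory's form of complex differentiability: the product rule and the
   removal of a zero become algebraic identities between slope functions. *)
Definition holomorphic_at (h : C -> C) (a : C) : Prop :=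
  exists k : C -> C, Ccontinuous k a /\ forall z, h z = (h a + (z - a) * k z)%C.

(** The slope function is the difference quotient, completed at [a] by the derivative. *)
Lemma ex_derive_holomorphic_at (h : C -> C) (a : C) :
  ex_derive (K := C_AbsRing) (V := C_NormedModule) h a -> holomorphic_at h a.
Proof.
intros [l [_ Hl]].
specialize (Hl a (fun P HP => HP)).
exists (fun z => if Ceq_dec z a then l else ((h z - h a) / (z - a))%C).
split.
- intros e He.
  assert (He2 : 0 < e / 2) by lra.
  destruct (Hl (mkposreal _ He2)) as [d Hd].
  exists d; split; [apply cond_pos|].
  intros z Hz.
  destruct (Ceq_dec a a) as [_|N]; [|now elim N].
  destruct (Ceq_dec z a) as [->|N].
  { unfold Cminus; rewrite Cplus_opp_r, Cmod_0; exact He. }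
  assert (Nz : (z - a)%C <> 0%C) by now rewrite <- Ceq_minus.
  assert (Pz := proj1 (Cmod_gt_0 _) Nz).
  assert (F : Cmod (h z - h a - (z - a) * l) <= e / 2 * Cmod (z - a)) by exact (Hd z Hz).
  replace ((h z - h a) / (z - a) - l)%C with ((h z - h a - (z - a) * l) * / (z - a))%C
    by (field; exact Nz).
  rewrite Cmod_mult, Cmod_inv by exact Nz.
  apply Rmult_lt_reg_r with (Cmod (z - a)); [exact Pz|].
  rewrite Rmult_assoc, Rinv_l by lra. nra.
- intros z.
  destruct (Ceq_dec z a) as [->|N]; [ring|].
  field; now rewrite <- Ceq_minus.
Qed.

Lemma holomorphic_at_Ccontinuous (h : C -> C) (a : C) : holomorphic_at h a -> Ccontinuous h a.
Proof.
intros [k [Hk E]].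
apply (Ccontinuous_ext_loc (fun z => h a + (z + - a) * k z)%C h a 1); [lra | |].
- intros z _; symmetry; apply E.
- repeat first [apply Ccontinuous_plus | apply Ccontinuous_mult | apply Ccontinuous_const |
    apply Ccontinuous_id | exact Hk].
Qed.

Lemma holomorphic_at_ext (g h : C -> C) (a : C) :
  (forall z, g z = h z) -> holomorphic_at g a -> holomorphic_at h a.
Proof.
intros E [k [Hk Ek]]; exists k; split; [exact Hk|].
intros z; rewrite <- !E; apply Ek.
Qed.

Lemma holomorphic_at_mult (g h : C -> C) (a : C) :
  holomorphic_at g a -> holomorphic_at h a -> holomorphic_at (fun z => g z * h z)%C a.
Proof.
intros Hg [k [Hk Ek]]; assert (Cg := holomorphic_at_Ccontinuous _ _ Hg).
destruct Hg as [j [Hj Ej]].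
(* From [g h - g(a) h(a) = (g - g(a)) h(a) + g (h - h(a))]; continuity of [g] is used here. *)
exists (fun z => h a * j z + g z * k z)%C; split.
- repeat first [apply Ccontinuous_plus | apply Ccontinuous_mult | apply Ccontinuous_const |
    assumption].
- intros z; rewrite (Ek z).
  transitivity (g z * h a + (z - a) * (g z * k z))%C; [ring|].
  rewrite (Ej z) at 1; ring.
Qed.

Lemma holomorphic_at_plus (g h : C -> C) (a : C) :
  holomorphic_at g a -> holomorphic_at h a -> holomorphic_at (fun z => g z + h z)%C a.
Proof.
intros [j [Hj Ej]] [k [Hk Ek]].
exists (fun z => j z + k z)%C; split; [now apply Ccontinuous_plus|].
intros z; rewrite (Ek z), (Ej z); ring.
Qed.

Lemma holomorphic_at_const (c a : C) : holomorphic_at (fun _ => c) a.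
Proof. exists (fun _ => 0%C); split; [apply Ccontinuous_const | intros; ring]. Qed.

Lemma holomorphic_at_id (a : C) : holomorphic_at (fun z => z) a.
Proof. exists (fun _ => 1%C); split; [apply Ccontinuous_const | intros; ring]. Qed.

(* Division by a simple zero leaves a function that is continuous everywhere but
   may a priori fail to be differentiable at the zero itself. *)
Lemma divide_zero (h : C -> C) (a : C) : (forall z, Ccontinuous h z) ->
  holomorphic_at h a -> h a = 0%C ->
  exists k, (forall z, h z = (z - a) * k z)%C /\ (forall z, Ccontinuous k z) /\
    forall b, b <> a -> holomorphic_at h b -> holomorphic_at k b.
Proof.
intros Ch [k [Hk Ek]] Ha; exists k.
assert (Ek' : forall z, h z = ((z - a) * k z)%C) by (intros z; rewrite (Ek z), Ha; ring).
split; [exact Ek'|].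
assert (Hsub : forall z b : C, z <> b -> (z + - b)%C <> 0%C)
  by (intros z b N; fold (Cminus z b); now rewrite <- Ceq_minus).
assert (Hfar : forall b, b <> a -> 0 < Cmod (b - a) /\ forall z, Cmod (z - b) < Cmod (b - a) -> z <> a).
{ intros b N; split; [now apply Cmod_gt_0, Hsub|].
  intros z Hz ->; rewrite Cmod_minus_sym in Hz; lra. }
assert (Hinv : forall b, b <> a -> Ccontinuous (fun z => / (z + - a))%C b).
{ intros b N e He.
  destruct (Ccontinuous_inv (b + - a)%C (Hsub b a N) e He) as [d [Hd H]].
  exists d; split; [exact Hd|]; intros z Hz; apply H.
  now replace (z + - a - (b + - a))%C with (z - b)%C by ring. }
split.
- intros b; destruct (Ceq_dec b a) as [->|N]; [exact Hk|].
  destruct (Hfar b N) as [P1 P2].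
  apply (Ccontinuous_ext_loc (fun z => h z * / (z + - a))%C k b _ P1).
  + intros z Hz; rewrite (Ek' z); field; now apply Hsub, P2.
  + apply Ccontinuous_mult; [apply Ch | now apply Hinv].
- intros b N [j [Hj Ej]].
  destruct (Hfar b N) as [P1 P2].
  (* Solving [(z - a) k(z) = (b - a) k(b) + (z - b) j(z)] gives [k(z) - k(b) = (z - b) (j(z) - k(b))
     / (z - a)]. At [z = a] the value is forced by the slope identity, which must hold for every
     [z]. *)
  exists (fun z => if Ceq_dec z a then ((k a - k b) / (a - b))%C
    else ((j z + - k b) * / (z + - a))%C); split.
  + apply (Ccontinuous_ext_loc (fun z => (j z + - k b) * / (z + - a))%C _ b _ P1).
    * intros z Hz; destruct (Ceq_dec z a) as [E|]; [|reflexivity].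
      now elim (P2 z Hz).
    * apply Ccontinuous_mult; [|now apply Hinv].
      apply Ccontinuous_plus; [exact Hj | apply Ccontinuous_const].
  + intros z; destruct (Ceq_dec z a) as [->|Nz].
    * field; apply (Hsub a b); now intros ->.
    * assert (E : ((z - a) * k z = (b - a) * k b + (z - b) * j z)%C)
        by (rewrite <- !Ek'; apply Ej).
      replace (k z) with ((z - a) * k z * / (z - a))%C by (field; now apply Hsub).
      rewrite E; field; now apply Hsub.
Qed.

(** The product vanishes at [a], so [k] itself is its slope function there: a simple zero repairs a
    merely continuous factor. *)
Lemma holomorphic_at_restore (k : C -> C) (a : C) : Ccontinuous k a ->
  holomorphic_at (fun z => (z - a) * k z)%C a.
Proof. intros Hk; exists k; split; [exact Hk | intros; ring]. Qed.

(** * The maximum modulus principle *)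

Lemma Cmod_le_2Rmax (z : C) : Cmod z <= 2 * Rmax (Rabs (fst z)) (Rabs (snd z)).
Proof.
eapply Rle_trans; [apply Cmod_2Rmax|].
apply Rmult_le_compat_r.
- eapply Rle_trans; [apply Rabs_pos | apply Rmax_l].
- assert (H := sqrt_sqrt 2 ltac:(lra)); assert (H' := sqrt_pos 2); nra.
Qed.

Lemma Cmod_lt_of_coords (x y u v d : R) :
  Rabs (u - x) < d / 2 -> Rabs (v - y) < d / 2 -> Cmod ((u, v) - (x, y)) < d.
Proof.
intros Hu Hv; eapply Rle_lt_trans; [apply Cmod_le_2Rmax|].
assert (Rmax (Rabs (u - x)) (Rabs (v - y)) < d / 2) by now apply Rmax_lub_lt.
change (2 * Rmax (Rabs (u - x)) (Rabs (v - y)) < d); lra.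
Qed.

Lemma Cmod_sqr (x y : R) : Cmod (x, y) ^ 2 = x ^ 2 + y ^ 2.
Proof. unfold Cmod; simpl fst; simpl snd; apply pow2_sqrt; nra. Qed.

(** The Cauchy-Riemann equations: the differential is multiplication by [l], the value of the slope
    function at the point, and the error is the increment times the variation of the slope. *)
Lemma holomorphic_at_real_imaginary (h : C -> C) (x y : R) : holomorphic_at h (x, y) ->
  exists l : C,
    differentiable_pt_lim (fun s t => fst (h (s, t))) x y (fst l) (- snd l) /\
    differentiable_pt_lim (fun s t => snd (h (s, t))) x y (snd l) (fst l).
Proof.
intros [k [Hk Ek]]; exists (k (x, y)).
assert (Est : forall e, 0 < e -> exists d, 0 < d /\ forall s t,
  Rabs (s - x) < d -> Rabs (t - y) < d ->
  Cmod (h (s, t) - h (x, y) - ((s, t) - (x, y)) * k (x, y)) <=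
    e * Rmax (Rabs (s - x)) (Rabs (t - y))).
{ intros e He; destruct (Hk (e / 2)) as [d [Hd H]]; [lra|].
  exists (d / 2); split; [lra|]; intros s t Hs Ht.
  rewrite (Ek (s, t)).
  replace (h (x, y) + ((s, t) - (x, y)) * k (s, t) - h (x, y) - ((s, t) - (x, y)) * k (x, y))%C
    with (((s, t) - (x, y)) * (k (s, t) - k (x, y)))%C by ring.
  rewrite Cmod_mult.
  assert (H1 := H (s, t) (Cmod_lt_of_coords _ _ _ _ _ Hs Ht)).
  assert (H2 : Cmod ((s, t) - (x, y)) <= 2 * Rmax (Rabs (s - x)) (Rabs (t - y)))
    by exact (Cmod_le_2Rmax ((s, t) - (x, y))%C).
  assert (H3 := Cmod_ge_0 (k (s, t) - k (x, y))).
  assert (H4 := Cmod_ge_0 ((s, t) - (x, y))).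
  nra. }
split; intros [e He]; simpl; destruct (Est e He) as [d [Hd H]];
  exists (mkposreal d Hd); simpl; intros s t Hs Ht; specialize (H s t Hs Ht);
  (eapply Rle_trans; [|exact H]); (eapply Rle_trans; [|apply Rmax_Cmod]).
- eapply Rle_trans; [|apply Rmax_l]; right; f_equal; simpl; ring.
- eapply Rle_trans; [|apply Rmax_r]; right; f_equal; simpl; ring.
Qed.

(** First move vertically on the line through [x], then horizontally by the mean value theorem, with
    [p] bounded near [(x, y)]. *)
Lemma continuity_2d_pt_of_partials (P p q : R -> R -> R) (x y : R) :
  (forall x y, is_derive (fun t => P t y) x (p x y)) ->
  (forall x y, is_derive (fun t => P x t) y (q x y)) ->
  continuity_2d_pt p x y -> continuity_2d_pt P x y.
Proof.
intros H1 H2 Hp [e He]; simpl.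
assert (Hy : continuity_pt (fun t => P x t) y).
{ apply continuity_pt_filterlim, (ex_derive_continuous (V := R_NormedModule)).
  exists (q x y); apply H2. }
assert (He2 : 0 < e / 2) by lra.
destruct (proj1 (continuity_pt_locally _ _) Hy (mkposreal _ He2)) as [d1 Hd1].
destruct (Hp (mkposreal 1 Rlt_0_1)) as [d2 Hd2]; simpl in *.
set (K := Rabs (p x y) + 1).
assert (HK : 0 < K) by (assert (H := Rabs_pos (p x y)); unfold K; lra).
assert (He3 : 0 < e / 2 / K) by now apply Rdiv_lt_0_compat.
assert (Hd : 0 < Rmin (Rmin d1 d2) (e / 2 / K))
  by (repeat apply Rmin_pos; try apply cond_pos; exact He3).
exists (mkposreal _ Hd); simpl; intros u v Hu Hv.
assert (M1 := Rmin_l (Rmin d1 d2) (e / 2 / K)); assert (M2 := Rmin_r (Rmin d1 d2) (e / 2 / K)).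
assert (M3 := Rmin_l d1 d2); assert (M4 := Rmin_r d1 d2).
destruct (MVT_gen (fun t => P t v) x u (fun t => p t v)) as [c [Hc E]].
{ intros; apply H1. }
{ intros t _; apply continuity_pt_filterlim, (ex_derive_continuous (V := R_NormedModule) (fun t => P t v)).
  exists (p t v); apply H1. }
assert (Hcx : Rabs (c - x) <= Rabs (u - x)).
{ revert Hc; unfold Rmin, Rmax; destruct (Rle_dec x u); intros Hc.
  - rewrite (Rabs_right (c - x)), (Rabs_right (u - x)); lra.
  - rewrite (Rabs_left1 (c - x)), (Rabs_left1 (u - x)); lra. }
assert (Hpc : Rabs (p c v) <= K).
{ assert (F := Hd2 c v ltac:(lra) ltac:(lra)); unfold K.
  assert (G := Rabs_triang (p c v - p x y) (p x y)).
  replace (p c v - p x y + p x y) with (p c v) in G by ring; lra. }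
assert (F1 : Rabs (P x v - P x y) < e / 2) by (apply Hd1; change (Rabs (v - y) < d1); lra).
assert (F2 : Rabs (P u v - P x v) < e / 2).
{ rewrite E, Rabs_mult.
  apply Rle_lt_trans with (K * Rabs (u - x)); [apply Rmult_le_compat_r; [apply Rabs_pos | exact Hpc]|].
  apply Rlt_le_trans with (K * (e / 2 / K)); [apply Rmult_lt_compat_l; lra|].
  right; field; lra. }
replace (P u v - P x y) with ((P u v - P x v) + (P x v - P x y)) by ring.
eapply Rle_lt_trans; [apply Rabs_triang | lra].
Qed.

(* Horizontal difference quotients of a real primitive [P] of [Re h] are twice
   differentiable with zero Laplacian, hence obey the elementary maximum principle;
   letting the step tend to 0 transfers it to [Re h]. *)
Lemma real_part_max_principle (h : C -> C) (r B : R) : (forall a, holomorphic_at h a) ->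
  0 <= r -> (forall x y, x ^ 2 + y ^ 2 = r ^ 2 -> fst (h (x, y)) <= B) ->
  forall x y, x ^ 2 + y ^ 2 <= r ^ 2 -> fst (h (x, y)) <= B.
Proof.
intros Hh Hr HB x y Hxy.
destruct (choice _ (fun z : C => holomorphic_at_real_imaginary h (fst z) (snd z)
  ltac:(destruct z; apply Hh))) as [l Hl].
set (u s t := fst (h (s, t))).
(* The form [u dx + w dy] is the real part of [h dz]; Cauchy-Riemann makes it closed. *)
set (w s t := - snd (h (s, t))).
assert (Du : forall s t, differentiable_pt_lim u s t (fst (l (s, t))) (- snd (l (s, t))))
  by (intros s t; apply (Hl (s, t))).
assert (Dw : forall s t, differentiable_pt_lim w s t (- snd (l (s, t))) (- fst (l (s, t)))).
{ intros s t e; destruct (proj2 (Hl (s, t)) e) as [d Hd]; exists d; intros s' t' Hs Ht.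
  eapply Rle_trans; [|apply (Hd s' t' Hs Ht)]; right; unfold w; simpl.
  rewrite <- Rabs_Ropp; f_equal; ring. }
assert (Cu : forall s t, continuity_2d_pt u s t)
  by (intros s t; eapply differentiable_pt_lim_continuity, Du).
destruct (primitive_exists u w _ _ _ Du Dw) as [P [P1 P2]].
assert (CP : forall s t, continuity_2d_pt P s t)
  by (intros s t; apply (continuity_2d_pt_of_partials P u w); auto).
apply le_epsilon; intros e He.
assert (HPI := PI_RGT_0).
(* Here [m eta] is the maximum of [u] on the circle shifted horizontally by [eta], so [m 0 <= B] and
   nearby values stay below [B + e / 2]. *)
destruct (fiber_max_continuous (fun eta t => u (r * cos t + eta) (r * sin t)) (- PI) PI ltac:(lra))
  as [m [Hm1 [Hm2 Hm3]]].
{ intros s t; apply continuity_2d_pt_comp; [apply Cu | |].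
  - apply continuity_2d_pt_plus; [|apply continuity_2d_pt_id1].
    apply (continuity_2d_pt_of_snd (fun t => r * cos t)), derivable_continuous_pt; reg.
  - apply (continuity_2d_pt_of_snd (fun t => r * sin t)), derivable_continuous_pt; reg. }
assert (Hm0 : m 0 <= B).
{ destruct (Hm2 0) as [t [_ ->]]; rewrite Rplus_0_r; apply HB, circle_param_norm. }
assert (He2 : 0 < e / 2) by lra.
destruct (proj1 (continuity_pt_locally m 0) (proj2 (continuity_pt_filterlim _ _) (Hm3 0))
  (mkposreal _ He2)) as [d1 Hd1].
destruct (proj1 (continuity_pt_locally (fun t => u t y) x)
  (proj2 (continuity_pt_filterlim _ _) (continuity_2d_pt_section1 _ _ _ (Cu x y)))
  (mkposreal _ He2)) as [d2 Hd2]; simpl in *.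
set (eta := Rmin d1 d2 / 2).
assert (Hmin : 0 < Rmin d1 d2) by (apply Rmin_pos; apply cond_pos).
assert (M1 := Rmin_l d1 d2); assert (M2 := Rmin_r d1 d2).
assert (Heta : 0 < eta) by (unfold eta; lra).
assert (MV : forall s t, exists c, 0 < c < eta /\ P (s + eta) t - P s t = eta * u (s + c) t).
{ intros s t.
  destruct (MVT_cor2 (fun z => P z t) (fun z => u z t) s (s + eta)) as [c [E Hc]]; [lra | |].
  - intros; apply is_derive_Reals, P1.
  - exists (c - s); split; [lra|].
    replace (s + (c - s)) with c by ring; rewrite E; ring. }
(* The increment of [P] is harmonic: its second derivatives are opposite increments of the real part
   of [l]. On the circle, [MV] turns it into [eta] times a value of [u] on a slightly shifted
   circle. *)
assert (HD : P (x + eta) y - P x y <= eta * (B + e / 2)).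
{ assert (shift : forall (g dg : R -> R) s, is_derive g (s + eta) (dg (s + eta)) ->
    is_derive (fun t => g (t + eta)) s (dg (s + eta))).
  { intros g dg s Hg; apply is_derive_Reals.
    assert (H := derivable_pt_lim_comp (fun t => t + eta) g s 1 (dg (s + eta))).
    rewrite Rmult_1_r in H; apply H; [|now apply is_derive_Reals].
    apply is_derive_Reals; auto_derive; [easy | ring]. }
  assert (U1 : forall s t, is_derive (fun z => u z t) s (fst (l (s, t)))).
  { intros s t; apply is_derive_Reals.
    assert (H := derivable_pt_lim_comp_2d u (fun z => z) (fun _ => t) s _ _ 1 0 (Du s t)
      (derivable_pt_lim_id s) (derivable_pt_lim_const t s)).
    now rewrite Rmult_1_r, Rmult_0_r, Rplus_0_r in H. }
  assert (W2 : forall s t, is_derive (fun z => w s z) t (- fst (l (s, t)))).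
  { intros s t; apply is_derive_Reals.
    assert (H := derivable_pt_lim_comp_2d w (fun _ => s) (fun z => z) t _ _ 0 1 (Dw s t)
      (derivable_pt_lim_const s t) (derivable_pt_lim_id t)).
    now rewrite Rmult_1_r, Rmult_0_r, Rplus_0_l in H. }
  apply (harmonic_max_principle (fun s t => P (s + eta) t - P s t)
    (fun s t => u (s + eta) t - u s t) (fun s t => w (s + eta) t - w s t)
    (fun s t => fst (l (s + eta, t)) - fst (l (s, t)))
    (fun s t => - fst (l (s + eta, t)) - - fst (l (s, t))) r); auto.
  - intros s t; apply continuity_2d_pt_minus; [|apply CP].
    apply (continuity_2d_pt_comp P (fun s _ => s + eta) (fun _ t => t)); [apply CP | |
      apply continuity_2d_pt_id2].
    apply (continuity_2d_pt_of_fst (fun s => s + eta)), derivable_continuous_pt; reg.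
  - intros s t; apply (is_derive_minus (V := R_NormedModule)); [|apply P1].
    apply (shift (fun z => P z t) (fun z => u z t)), P1.
  - intros s t; apply (is_derive_minus (V := R_NormedModule)); apply P2.
  - intros s t; apply (is_derive_minus (V := R_NormedModule)); [|apply U1].
    apply (shift (fun z => u z t) (fun z => fst (l (z, t)))), U1.
  - intros s t; apply (is_derive_minus (V := R_NormedModule)); apply W2.
  - intros; ring.
  - intros s t Hst.
    destruct (circle_param s t r Hr Hst) as [th [Hth [-> ->]]].
    destruct (MV (r * cos th) (r * sin th)) as [c [Hc ->]].
    apply Rmult_le_compat_l; [lra|].
    eapply Rle_trans; [apply (Hm1 c th Hth)|].
    assert (F := Hd1 c ltac:(change (Rabs (c - 0) < d1); apply Rabs_def1; unfold eta in Hc; lra)).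
    apply Rabs_def2 in F; lra. }
destruct (MV x y) as [c [Hc E]].
assert (F := Hd2 (x + c) ltac:(change (Rabs (x + c - x) < d2); apply Rabs_def1; unfold eta in Hc; lra)).
apply Rabs_def2 in F; simpl in F.
rewrite E in HD; apply Rmult_le_reg_l in HD; [|exact Heta].
fold (u x y); lra.
Qed.

(** Rotate by the unimodular constant [c] that makes [c * h z] real and nonnegative, then apply the
    principle for real parts to [c * h]. *)
Theorem max_modulus_principle (h : C -> C) (r B : R) : (forall a, holomorphic_at h a) ->
  0 <= r -> (forall z, Cmod z = r -> Cmod (h z) <= B) ->
  forall z, Cmod z <= r -> Cmod (h z) <= B.
Proof.
intros Hh Hr HB z Hz.
(* No rotation is defined when [h z = 0]; then [0 <= B] is read off at the point [r] of the
   circle. *)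
destruct (Ceq_dec (h z) 0) as [E|N].
{ rewrite E, Cmod_0.
  eapply Rle_trans; [apply (Cmod_ge_0 (h (RtoC r))) | apply HB].
  rewrite Cmod_R; apply Rabs_right; lra. }
assert (Pz := proj1 (Cmod_gt_0 _) N).
set (c := (Cconj (h z) / Cmod (h z))%C).
assert (Nm : RtoC (Cmod (h z)) <> 0%C) by (intros E; apply RtoC_inj in E; lra).
assert (Hc : Cmod c = 1).
{ unfold c; rewrite Cmod_div, Cmod_conj, Cmod_R, Rabs_right by (assumption || lra).
  field; lra. }
assert (Hcz : (c * h z)%C = RtoC (Cmod (h z))).
{ unfold c; transitivity ((h z * Cconj (h z)) / Cmod (h z))%C; [field; exact Nm|].
  rewrite <- Cmod2_conj, RtoC_pow; field; exact Nm. }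
assert (F : fst (c * h z)%C <= B).
{ destruct z as [x y].
  apply (real_part_max_principle (fun z => c * h z)%C r B); auto.
  - intros a; apply holomorphic_at_mult; [apply holomorphic_at_const | apply Hh].
  - intros s t Hst.
    eapply Rle_trans; [apply Rle_abs|].
    eapply Rle_trans; [apply (re_le_Cmod (c * h (s, t)))|].
    rewrite Cmod_mult, Hc, Rmult_1_l; apply HB.
    unfold Cmod; simpl fst; simpl snd; rewrite Hst; now apply sqrt_pow2.
  - rewrite <- Cmod_sqr; apply pow_incr; split; [apply Cmod_ge_0 | exact Hz]. }
rewrite Hcz in F; exact F.
Qed.

(** * Growth of the maximum modulus *)

(* Writing [h z - z h(1) = z (z - 1) k z], the function [z (z - 1) (k z)^3] is entire
   even where [k] is merely continuous, and it is [O(1/R)] on the given circles. *)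
Lemma linear_of_linear_growth (h : C -> C) :
  (forall a, holomorphic_at h a) -> h 0%C = 0%C ->
  (forall K, exists R, K < R /\ forall z, Cmod z = R -> Cmod (h z) <= R) ->
  forall z, h z = (z * h 1)%C.
Proof.
intros Hh H0 Hgrow.
set (phi z := (h z + - h 1 * z)%C).
assert (Hphi : forall a, holomorphic_at phi a).
{ intros a; apply holomorphic_at_plus; [apply Hh|].
  apply holomorphic_at_mult; [apply holomorphic_at_const | apply holomorphic_at_id]. }
assert (phi0 : phi 0%C = 0%C) by (unfold phi; rewrite H0; ring).
assert (phi1 : phi 1%C = 0%C) by (unfold phi; ring).
assert (N10 : RtoC 1 <> RtoC 0) by (intros E; apply RtoC_inj in E; lra).
destruct (divide_zero phi 0) as [k0 [E0 [C0 D0]]];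
  [intros; now apply holomorphic_at_Ccontinuous | apply Hphi | exact phi0 |].
assert (k01 : k0 1%C = 0%C).
{ rewrite <- phi1, (E0 1%C); ring. }
destruct (divide_zero k0 1) as [k [E1 [C1 D1]]];
  [exact C0 | apply D0; auto | exact k01 |].
set (Psi z := ((z - 0) * ((z - 1) * (k z * k z * k z)))%C).
assert (C3 : forall a, Ccontinuous (fun z => k z * k z * k z)%C a)
  by (intros a; repeat apply Ccontinuous_mult; apply C1).
assert (Hsub : forall c a, Ccontinuous (fun z => z - c)%C a).
{ intros c a; apply Ccontinuous_plus; [apply Ccontinuous_id | apply Ccontinuous_const]. }
(* At 0 and at 1 the corresponding linear factor restores differentiability; elsewhere [k] is
   differentiable. *)
assert (HPsi : forall a, holomorphic_at Psi a).
{ intros a; destruct (Ceq_dec a 0) as [->|N0].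
  { apply (holomorphic_at_restore (fun z => (z - 1) * (k z * k z * k z))%C).
    apply Ccontinuous_mult; auto. }
  destruct (Ceq_dec a 1) as [->|N1].
  { apply (holomorphic_at_ext (fun z => (z - 1) * ((z - 0) * (k z * k z * k z)))%C).
    - intros z; unfold Psi; ring.
    - apply (holomorphic_at_restore (fun z => (z - 0) * (k z * k z * k z))%C).
      apply Ccontinuous_mult; auto. }
  assert (Hk : holomorphic_at k a) by (apply D1; [exact N1 | apply D0; auto]).
  assert (Hlin : forall c, holomorphic_at (fun z => z - c)%C a).
  { intros c; apply holomorphic_at_plus; [apply holomorphic_at_id | apply holomorphic_at_const]. }
  repeat apply holomorphic_at_mult; auto. }
assert (Ephi : forall z, phi z = ((z - 0) * ((z - 1) * k z))%C)
  by (intros z; now rewrite (E0 z), (E1 z)).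
set (c := 1 + Cmod (h 1%C)).
assert (Hc : 1 <= c) by (assert (F := Cmod_ge_0 (h 1%C)); unfold c; lra).
assert (Hc3 : 1 <= c ^ 3) by (rewrite <- (pow1 3); apply pow_incr; lra).
assert (Small : forall e, 0 < e -> forall z, Cmod (Psi z) <= e).
{ intros e He z.
  (* Radius above 2 gives [|w - 1| >= r / 2], and radius above [|z|] puts [z] in the disc. Since
     [Psi = phi * k^2], with [|phi| <= c * r] and [|k| <= 2 * c / r], one gets
     [|Psi| <= 4 * c^3 / r <= e]. *)
  destruct (Hgrow (Rmax (Rmax 2 (Cmod z)) (4 * c ^ 3 / e))) as [r [HR Hr]].
  assert (M1 := Rmax_l (Rmax 2 (Cmod z)) (4 * c ^ 3 / e)).
  assert (M2 := Rmax_r (Rmax 2 (Cmod z)) (4 * c ^ 3 / e)).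
  assert (M3 := Rmax_l 2 (Cmod z)); assert (M4 := Rmax_r 2 (Cmod z)).
  assert (HRe : 4 * c ^ 3 <= e * r).
  { apply Rmult_le_reg_r with (/ e); [now apply Rinv_0_lt_compat|].
    replace (e * r * / e) with r by (field; lra). unfold Rdiv in M2; lra. }
  apply (max_modulus_principle Psi r e HPsi); [lra | | lra].
  intros w Hw.
  assert (B1 : Cmod (phi w) <= c * r).
  { unfold phi; eapply Rle_trans; [apply Cmod_triangle|].
    rewrite Cmod_mult, Cmod_opp, Hw; specialize (Hr w Hw); unfold c; lra. }
  assert (B2 : r / 2 <= Cmod (w - 1)).
  { assert (F := Cmod_minus_triangle w 1); rewrite Cmod_1, Hw in F; lra. }
  assert (EP : Cmod (phi w) = r * (Cmod (w - 1) * Cmod (k w))).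
  { rewrite Ephi, !Cmod_mult. f_equal. rewrite <- Hw; f_equal; ring. }
  assert (ES : Cmod (Psi w) = Cmod (phi w) * (Cmod (k w) * Cmod (k w))).
  { rewrite <- !Cmod_mult; f_equal; rewrite Ephi; unfold Psi; ring. }
  assert (Kp := Cmod_ge_0 (k w)).
  assert (B3 : r * Cmod (k w) <= 2 * c).
  { assert (r * (r / 2 * Cmod (k w)) <= c * r).
    { rewrite EP in B1; eapply Rle_trans; [|exact B1].
      apply Rmult_le_compat_l; [lra|]; now apply Rmult_le_compat_r. }
    apply Rmult_le_reg_l with (r / 2); [lra|]. lra. }
  rewrite ES.
  assert (P1 : (r * Cmod (k w)) ^ 2 <= (2 * c) ^ 2).
  { apply pow_incr; split; [apply Rmult_le_pos; lra | exact B3]. }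
  assert (P2 : Cmod (phi w) * (r * Cmod (k w)) ^ 2 <= c * r * (2 * c) ^ 2).
  { apply Rmult_le_compat; [apply Cmod_ge_0 | apply pow2_ge_0 | exact B1 | exact P1]. }
  apply Rmult_le_reg_l with (r * r); [apply Rmult_lt_0_compat; lra|].
  replace (r * r * (Cmod (phi w) * (Cmod (k w) * Cmod (k w))))
    with (Cmod (phi w) * (r * Cmod (k w)) ^ 2) by ring.
  eapply Rle_trans; [exact P2|].
  replace (c * r * (2 * c) ^ 2) with (r * (4 * c ^ 3)) by ring.
  replace (r * r * e) with (r * (e * r)) by ring.
  apply Rmult_le_compat_l; lra. }
intros z.
assert (PZ : Psi z = 0%C).
{ apply Cmod_eq_0, Rle_antisym; [|apply Cmod_ge_0].
  apply le_epsilon; intros e He; rewrite Rplus_0_l; now apply Small. }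
assert (FZ : phi z = 0%C).
{ rewrite Ephi; unfold Psi in PZ.
  destruct (Ceq_dec (z - 0) 0) as [->|n1]; [ring|].
  destruct (Ceq_dec (z - 1) 0) as [->|n2]; [ring|].
  destruct (Ceq_dec (k z) 0) as [->|n3]; [ring|].
  exfalso; revert PZ; repeat apply Cmult_neq_0; assumption. }
unfold phi in FZ.
replace (h z) with (h z + - h 1 * z + z * h 1)%C by ring; rewrite FZ; ring.
Qed.

Lemma linear_polynomial (f : C -> C) (c : C) :
  (forall z, f z = (z * c)%C) -> polynomial_function f.
Proof.
intros E; exists 1%nat, (fun k => match k with O => RtoC 0 | _ => c end); intros z.
rewrite sum_Sn, sum_O, E; unfold plus; simpl; ring.
Qed.

Lemma max_of_spec (E : R -> Prop) : (exists m, is_max E m) -> is_max E (max_of E).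
Proof. apply epsilon_spec. Qed.

Section MaxModulus.
Variable f : C -> C.
Hypothesis hf : entire f.

Lemma entire_holomorphic_at (a : C) : holomorphic_at f a.
Proof. apply ex_derive_holomorphic_at, hf. Qed.

Lemma Cmod_continuity_2d (x y : R) : continuity_2d_pt (fun s t => Cmod (f (s, t))) x y.
Proof.
intros [e He]; simpl.
destruct (holomorphic_at_Ccontinuous _ _ (entire_holomorphic_at (x, y)) e He) as [d [Hd H]].
assert (Hd2 : 0 < d / 2) by lra.
exists (mkposreal _ Hd2); simpl; intros u v Hu Hv.
specialize (H (u, v) (Cmod_lt_of_coords _ _ _ _ _ Hu Hv)).
assert (T1 := Cmod_minus_triangle (f (u, v)) (f (x, y))).
assert (T2 := Cmod_minus_triangle (f (x, y)) (f (u, v))).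
rewrite Cmod_minus_sym in T2; apply Rabs_def1; lra.
Qed.

(** The angular parametrization shows that each circle maximum exists, so [max_of] is not at its
    unspecified default and agrees with the continuous fiber maximum for [r >= 0]. *)
Lemma max_modulus_spec :
  (forall r z, 0 <= r -> Cmod z = r -> Cmod (f z) <= max_modulus f r) /\
  (forall r, 0 <= r -> exists z, Cmod z = r /\ max_modulus f r = Cmod (f z)) /\
  (forall r e, 0 <= r -> 0 < e -> exists d, 0 < d /\
    forall s, 0 <= s -> Rabs (s - r) < d -> Rabs (max_modulus f s - max_modulus f r) < e).
Proof.
assert (HPI := PI_RGT_0).
destruct (fiber_max_continuous _ (- PI) PI ltac:(lra)
  (polar_continuity _ Cmod_continuity_2d)) as [m [Hm1 [Hm2 Hm3]]].
assert (Hmax : forall r, 0 <= r ->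
  is_max (fun x => exists z : C, Cmod z = r /\ x = Cmod (f z)) (m r)).
{ intros r Hr; split.
  - destruct (Hm2 r) as [t [_ Ht]]; exists (r * cos t, r * sin t); split; [|exact Ht].
    unfold Cmod; simpl fst; simpl snd; rewrite circle_param_norm; now apply sqrt_pow2.
  - intros x [[a b] [Hz ->]].
    assert (E := Cmod_sqr a b); rewrite Hz in E.
    destruct (circle_param a b r Hr (eq_sym E)) as [t [Ht [-> ->]]]; now apply Hm1. }
assert (Heq : forall r, 0 <= r -> max_modulus f r = m r).
{ intros r Hr; destruct (max_of_spec _ (ex_intro _ _ (Hmax r Hr))) as [A1 A2].
  destruct (Hmax r Hr) as [B1 B2].
  apply Rle_antisym; [now apply B2 | now apply A2]. }
split; [|split].
- intros r z Hr Hz; rewrite Heq by exact Hr; apply (Hmax r Hr); now exists z.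
- intros r Hr; rewrite Heq by exact Hr; apply (Hmax r Hr).
- intros r e Hr He.
  destruct (proj1 (continuity_pt_locally m r) (proj2 (continuity_pt_filterlim _ _) (Hm3 r))
    (mkposreal e He)) as [d Hd].
  exists d; split; [apply cond_pos|]; intros s Hs Hsr.
  rewrite !Heq by assumption; apply Hd, Hsr.
Qed.

Lemma max_modulus_increasing (r s : R) : 0 <= r <= s -> max_modulus f r <= max_modulus f s.
Proof.
intros [Hr Hs].
destruct max_modulus_spec as [A1 [A2 _]].
destruct (A2 r Hr) as [z [Hz ->]].
apply (max_modulus_principle f s); [apply entire_holomorphic_at | lra | | lra].
intros w Hw; apply A1; [lra | exact Hw].
Qed.

Lemma max_modulus_eventually_above : f 0%C = 0%C -> ~ polynomial_function f ->
  exists r0, 0 <= r0 /\ forall r, r0 <= r -> r < max_modulus f r.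
Proof.
intros H0 Hpol; apply NNPP; intros N; apply Hpol, (linear_polynomial f (f 1%C)).
apply linear_of_linear_growth; [apply entire_holomorphic_at | exact H0 |].
intros K; apply NNPP; intros N'; apply N.
(* Any [r] beyond this bound with [M r <= r] also satisfies [K < r], as the growth lemma
   requires. *)
exists (Rmax 0 (K + 1)); split; [apply Rmax_l|].
assert (M1 := Rmax_l 0 (K + 1)); assert (M2 := Rmax_r 0 (K + 1)).
intros r Hr; apply Rnot_le_lt; intros Hle; apply N'.
exists r; split; [lra|]; intros z Hz.
eapply Rle_trans; [|exact Hle]; apply max_modulus_spec; [lra | exact Hz].
Qed.

End MaxModulus.

(** * Iteration of a monotone continuous function *)

Section MonotoneIteration.
Variable M : R -> R.
Hypothesis M_zero : M 0 = 0.
Hypothesis M_incr : forall r s, 0 <= r <= s -> M r <= M s.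
Hypothesis M_cont : forall r e, 0 <= r -> 0 < e -> exists d, 0 < d /\
  forall s, 0 <= s -> Rabs (s - r) < d -> Rabs (M s - M r) < e.

Lemma iter_nonneg (n : nat) (r : R) : 0 <= r -> 0 <= Nat.iter n M r.
Proof.
intros Hr; induction n as [|n IH]; [exact Hr|].
simpl; rewrite <- M_zero at 1; apply M_incr; lra.
Qed.

Lemma iter_zero (n : nat) : Nat.iter n M 0 = 0.
Proof. induction n as [|n IH]; [reflexivity | simpl; now rewrite IH]. Qed.

Lemma iter_incr (n : nat) (r s : R) : 0 <= r <= s -> Nat.iter n M r <= Nat.iter n M s.
Proof.
intros Hrs; induction n as [|n IH]; [simpl; lra|].
apply M_incr; split; [apply iter_nonneg; lra | exact IH].
Qed.

Lemma iter_cont (n : nat) (r e : R) : 0 <= r -> 0 < e -> exists d, 0 < d /\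
  forall s, 0 <= s -> Rabs (s - r) < d -> Rabs (Nat.iter n M s - Nat.iter n M r) < e.
Proof.
intros Hr; revert e; induction n as [|n IH]; intros e He; [now exists e|].
destruct (M_cont _ e (iter_nonneg n r Hr) He) as [d [Hd H]].
destruct (IH d Hd) as [d' [Hd' H']].
exists d'; split; [exact Hd'|]; intros s Hs Hsr.
apply H; [now apply iter_nonneg | now apply H'].
Qed.

Definition escapes (r : R) : Prop := is_lim_seq (fun n => Nat.iter n M r) p_infty.

Lemma escapes_incr (r s : R) : 0 <= r <= s -> escapes r -> escapes s.
Proof.
intros Hrs; apply is_lim_seq_le_p_loc.
exists 0%nat; intros n _; now apply iter_incr.
Qed.

Lemma escapes_shift (k : nat) (r : R) : escapes (Nat.iter k M r) <-> escapes r.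
Proof.
unfold escapes; rewrite (is_lim_seq_incr_n (fun n => Nat.iter n M r) k).
split; apply is_lim_seq_ext; intros n; now rewrite Nat.iter_add.
Qed.

Lemma escapes_exceeds (r K : R) : escapes r ->
  exists n0, forall n, (n0 <= n)%nat -> K < Nat.iter n M r.
Proof. intros H; apply (H (fun x => K < x)); now exists K. Qed.

(** An iterate above [r0] would escape, and then so would [r0], since escaping ignores finitely many
    steps. *)
Lemma nonescaping_iter (r0 : R) (n : nat) : 0 <= r0 -> ~ escapes r0 ->
  (forall s, r0 < s -> escapes s) -> Nat.iter n M r0 <= r0.
Proof.
intros Hr0 N Habove; apply Rnot_lt_le; intros Hlt; apply N.
apply (escapes_shift n), Habove, Hlt.
Qed.

Hypothesis M_above : exists r0, 0 <= r0 /\ forall r, r0 <= r -> r < M r.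

(** Beyond [r0] the orbit increases; a finite limit would be a fixed point by continuity, against
    [l < M l]. *)
Lemma escapes_eventually : exists r0, 0 <= r0 /\ forall r, r0 <= r -> escapes r.
Proof.
destruct M_above as [r0 [Hr0 Habove]]; exists r0; split; [exact Hr0|]; intros r Hr.
assert (Hge : forall n, r <= Nat.iter n M r).
{ induction n as [|n IH]; [simpl; lra|].
  simpl; apply Rlt_le, (Rle_lt_trans _ _ _ IH), Habove; lra. }
assert (Hinc : forall n, Nat.iter n M r <= Nat.iter (S n) M r).
{ intros n; simpl; apply Rlt_le, Habove; specialize (Hge n); lra. }
assert (Hlim := Lim_seq_correct _ (ex_lim_seq_incr _ Hinc)).
unfold escapes; destruct (Lim_seq (fun n => Nat.iter n M r)) as [l| |]; [exfalso | exact Hlim | exfalso].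
- assert (Hl : r0 <= l).
  { apply (is_lim_seq_le (fun _ => r0) _ r0 l) in Hlim; [exact Hlim | | apply is_lim_seq_const].
    intros n; specialize (Hge n); lra. }
  assert (HM : is_lim_seq (fun n => M (Nat.iter n M r)) (M l)).
  { apply is_lim_seq_spec; intros e.
    destruct (M_cont l e ltac:(lra) (cond_pos e)) as [d [Hd H]].
    apply is_lim_seq_spec in Hlim; destruct (Hlim (mkposreal d Hd)) as [n0 Hn0].
    exists n0; intros n Hn; apply H; [specialize (Hge n); lra | now apply Hn0]. }
  apply is_lim_seq_incr_1 in Hlim.
  assert (E := is_lim_seq_unique _ _ Hlim); simpl in E.
  rewrite (is_lim_seq_unique _ _ HM) in E; injection E as E.
  specialize (Habove l Hl); lra.
- destruct (Hlim (fun x => x < r)) as [n Hn]; [now exists r|].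
  specialize (Hn n (le_n _)); specialize (Hge n); lra.
Qed.

(** The set contains 0 and is bounded. If its supremum [m] escaped, some iterate of [m] would exceed
    [r0]; by continuity the same iterate of every [r] in the set close to [m] would too, so [m - d]
    would be a smaller upper bound. *)
Lemma nonescaping_max : exists m, is_max (fun r => 0 <= r /\ ~ escapes r) m.
Proof.
destruct escapes_eventually as [r0 [Hr0 Hesc]].
assert (E0 : ~ escapes 0).
{ intros H; destruct (escapes_exceeds 0 0 H) as [n Hn].
  specialize (Hn n (le_n _)); rewrite iter_zero in Hn; lra. }
destruct (completeness (fun r => 0 <= r /\ ~ escapes r)) as [m [Hm1 Hm2]].
- exists r0; intros r [Hr N]; apply Rnot_lt_le; intros Hlt; apply N, Hesc; lra.
- exists 0; split; [lra | exact E0].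
- exists m; split; [|exact Hm1].
  assert (Hm : 0 <= m) by (apply Hm1; split; [lra | exact E0]).
  split; [exact Hm|]; intros H.
  destruct (escapes_exceeds m r0 H) as [n Hn]; specialize (Hn n (le_n _)).
  destruct (iter_cont n m (Nat.iter n M m - r0) Hm ltac:(lra)) as [d [Hd Hc]].
  assert (Hle : m <= m - d).
  { apply Hm2; intros r [Hr N]; apply Rnot_lt_le; intros Hlt; apply N.
    assert (r <= m) by (apply Hm1; now split).
    apply (escapes_shift n), Hesc.
    assert (F := Hc r Hr ltac:(apply Rabs_def1; lra)).
    apply Rabs_def2 in F; lra. }
  lra.
Qed.

(** Since [M^n m <= m < b n], continuity leaves room to the right of [m]. Each induction step
    shrinks [s], and monotonicity preserves the earlier bounds. *)
Lemma iter_near_nonescaping (m : R) (l : nat) (b : nat -> R) :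
  is_max (fun r => 0 <= r /\ ~ escapes r) m ->
  (forall n, m < b n) ->
  exists s, m < s /\ forall n, (n <= l)%nat -> Nat.iter n M s <= b n.
Proof.
intros [[Hm Hesc] Hmax] Hb.
assert (Habove : forall s, m < s -> escapes s).
{ intros s Hs; apply NNPP; intros N.
  assert (s <= m) by (apply Hmax; split; [lra | exact N]); lra. }
induction l as [|l [s [Hs Hsl]]].
- exists (b 0%nat); split; [apply Hb|].
  intros n Hn; replace n with 0%nat by lia; simpl; lra.
- assert (Hfix := nonescaping_iter m (S l) Hm Hesc Habove).
  destruct (iter_cont (S l) m (b (S l) - m) Hm ltac:(specialize (Hb (S l)); lra)) as [d [Hd Hc]].
  exists (Rmin s (m + d / 2)).
  assert (M1 := Rmin_l s (m + d / 2)); assert (M2 := Rmin_r s (m + d / 2)).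
  assert (Hlt : m < Rmin s (m + d / 2)) by (apply Rmin_glb_lt; lra).
  split; [exact Hlt|].
  intros n Hn; destruct (Nat.eq_dec n (S l)) as [->|Hne].
  + assert (F := Hc (Rmin s (m + d / 2)) ltac:(lra) ltac:(apply Rabs_def1; lra)).
    apply Rabs_def2 in F; lra.
  + eapply Rle_trans; [apply iter_incr|apply Hsl; lia]; lra.
Qed.

End MonotoneIteration.

(** * The fast escaping set *)

Lemma orbit_modulus_bound (f : C -> C) (k : nat) (z : C) (r : R) : entire f ->
  f 0%C = 0%C -> Cmod z <= r -> Cmod (Nat.iter k f z) <= Nat.iter k (max_modulus f) r.
Proof.
intros hf H0 Hz.
assert (Hr := Rle_trans _ _ _ (Cmod_ge_0 z) Hz).
induction k as [|k IH]; [exact Hz|]; simpl.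
eapply Rle_trans; [|apply (max_modulus_increasing f hf); split; [apply Cmod_ge_0 | exact IH]].
apply (max_modulus_spec f hf); [apply Cmod_ge_0 | reflexivity].
Qed.

Theorem theorem6p1 (f : C -> C) (hf : transcendental_entire f)
    (hf0 : f (RtoC 0) = RtoC 0) :
  is_max (nonescaping_radius f) (R_of f) /\
  forall rho : R, 0 < rho -> radius_escapes f rho ->
    forall z : C,
      fast_escaping f rho z <->
      exists R' : R, R_of f < R' /\ A_level f R' z.
Proof.
destruct hf as [hent hpol].
set (M := max_modulus f).
destruct (max_modulus_spec f hent) as [_ [Mattained Mcont]].
assert (Mincr := max_modulus_increasing f hent).
assert (Mabove := max_modulus_eventually_above f hent hf0 hpol).
fold M in Mattained, Mcont, Mincr, Mabove.
assert (M0 : M 0 = 0).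
{ destruct (Mattained 0 (Rle_refl 0)) as [z [Hz ->]].
  apply Cmod_eq_0 in Hz; rewrite Hz, hf0; apply Cmod_0. }
assert (Hmax : is_max (nonescaping_radius f) (R_of f))
  by exact (max_of_spec _ (nonescaping_max M M0 Mincr Mcont Mabove)).
split; [exact Hmax|].
intros rho Hrho Hesc z.
set (m := R_of f) in *.
destruct Hmax as [[Hm Hmesc] Hmle].
assert (Hesc_above : forall s, m < s -> escapes M s).
{ intros s Hs; apply NNPP; intros N.
  assert (s <= m) by (apply Hmle; split; [lra | exact N]); lra. }
unfold fast_escaping, A_level, max_modulus_iter; fold M.
split.
- intros [l [Hl Hz]].
  assert (Hmrho : m < rho).
  { apply Rnot_le_lt; intros Hle; apply Hmesc.
    apply (escapes_incr M M0 Mincr rho m); [lra | exact Hesc]. }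
  assert (Horbit : forall n, m < Cmod (Nat.iter n f z)).
  { intros n; apply Rnot_le_lt; intros Hle.
    destruct (escapes_exceeds M rho m Hesc) as [N HN].
    (* Late enough that [M^j rho > m] and [j + l >= n], and at least 1: time [j + l] lies above [m]
       by fast escape, but below it once the orbit has entered the disc. *)
    set (j := S (N + n)).
    assert (F1 := HN j ltac:(lia)).
    assert (F2 := Hz j ltac:(lia)).
    assert (F3 := orbit_modulus_bound f (j + l - n) _ m hent hf0 Hle).
    rewrite <- Nat.iter_add in F3; replace (j + l - n + n)%nat with (j + l)%nat in F3 by lia.
    assert (F4 := nonescaping_iter M m (j + l - n) Hm Hmesc Hesc_above).
    fold M in F3; lra. }
  (* The first entry of the minimum settles [n <= l]; the second, at [n = l], gives [M^l s <= rho]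
     for the later [n]. *)
  destruct (iter_near_nonescaping M M0 Mincr Mcont m l
    (fun n => Rmin (Cmod (Nat.iter n f z)) rho)) as [s [Hs Hsl]].
  { split; [split; assumption | exact Hmle]. }
  { intros n; now apply Rmin_glb_lt. }
  exists s; split; [exact Hs|]; intros n Hn.
  destruct (Nat.le_gt_cases n l) as [Hnl|Hnl].
  + eapply Rle_trans; [apply Hsl, Hnl | apply Rmin_l].
  (* Here [n - l >= 1], and [M^n s = M^(n-l) (M^l s) <= M^(n-l) rho <= |f^n z|]. *)
  + specialize (Hz (n - l)%nat ltac:(lia)).
    replace (n - l + l)%nat with n in Hz by lia.
    eapply Rle_trans; [|exact Hz].
    replace (Nat.iter n M s) with (Nat.iter (n - l) M (Nat.iter l M s))
      by (rewrite <- Nat.iter_add; f_equal; lia).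
    apply (iter_incr M M0 Mincr); split; [apply (iter_nonneg M M0 Mincr); lra|].
    eapply Rle_trans; [apply Hsl, le_n | apply Rmin_r].
- intros [s [Hs Hz]].
  destruct (escapes_exceeds M s rho (Hesc_above s Hs)) as [N HN].
  (* The successor ensures [l >= 1]; as [M^l s > rho], applying [M^n] compares the two orbits. *)
  exists (S N); split; [lia|]; intros n Hn.
  eapply Rle_trans; [|apply Hz; lia].
  rewrite Nat.iter_add; apply (iter_incr M M0 Mincr).
  split; [lra|]; apply Rlt_le, HN; lia.
Qed.
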